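(* Let $q>1$ be a real number, let $\mathbb{E}\neq\{0\}$ be a complex Banach space, and let $m=(m_p)_{p\ge0}$ be a sequence of positive real numbers with $m_0=1$. Then $m$ preserves $q$-Gevrey order if and only if $m$ is a sequence of $q$-Gevrey order $0$, i.e. if and only if there exist $a,A>0$ and $\alpha,\beta\in\mathbb{R}$ such that $a^pp!^{\alpha}\le m_p\le A^pp!^{\beta}$ for every $p\ge0$.
   Context: $\mathbb{E}$ is a complex Banach space with norm $\|\cdot\|_{\mathbb{E}}$; $\mathbb{E}[[t]]$ is the space of formal power series in $t$ with coefficients in $\mathbb{E}$. For $s\in\mathbb{R}$, $\mathbb{E}[[t]]_{q,s}$ is the set of all formal power series $\sum_{p\ge0}a_pt^p\in\mathbb{E}[[t]]$ such that there exist $A,B>0$ and $\alpha\in\mathbb{R}$ with $\|a_p\|_{\mathbb{E}}\le AB^{p}p!^{\alpha}q^{s\frac{p(p-1)}{2}}$ for all integers $p\ge0$. The formal $m$-Borel operator is $\mathcal{B}_{m,t}\left(\sum_{p\ge0}a_pt^p\right)=\sum_{p\ge0}\frac{a_p}{m_p}t^p$. Definition: $m$ preserves $q$-Gevrey order if for every $s\in\mathbb{R}$ and all $\hat{u}\in\mathbb{E}[[t]]$ one has $\hat{u}\in\mathbb{E}[[t]]_{q,s}$ if and only if $\mathcal{B}_{m,t}\hat{u}\in\mathbb{E}[[t]]_{q,s}$. Definition: $m$ is of $q$-Gevrey order $s\in\mathbb{R}$ if there exist $a,A>0$ and $\alpha,\beta\in\mathbb{R}$ such that $a^pp!^{\alpha}q^{s\frac{p(p-1)}{2}}\le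 m_{p}\le A^pp!^{\beta}q^{s\frac{p(p-1)}{2}}$ for every $p\ge0$. *)

(* Defs.v *)
From mathcomp Require Import all_boot all_order all_algebra.
From mathcomp Require Import complex.
From mathcomp Require Import all_classical all_reals all_analysis.

Set Implicit Arguments.
Unset Strict Implicit.
Unset Printing Implicit Defensive.

Import Order.TTheory GRing.Theory Num.Theory.
Import numFieldNormedType.Exports.

Local Open Scope ring_scope.
Local Open Scope complex_scope.

Section QGevrey.
Context {R : realType}.

(* A formal power series is identified with its sequence of coefficients. *)
Definition formal_series (E : Type) := nat -> E.

(* The norm of a [normedModType R[i]] takes its values in [R[i]]; there,
   [z <= x%:C] means that z is real and at most x. *)
Definition qGevrey_series (q s : R) (E : normedModType R[i])
    (u : formal_series E) : Prop :=
  exists A B alpha : R, [/\ 0 < A, 0 < B &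
    forall p : nat,
      `|u p| <= (A * B ^+ p * p`!%:R `^ alpha
                 * q `^ (s * (p%:R * (p%:R - 1) / 2)))%:C].

Definition formal_borel (m : nat -> R) (E : normedModType R[i])
    (u : formal_series E) : formal_series E :=
  fun p => ((m p)^-1)%:C *: u p.

Definition preserves_qGevrey_order (q : R) (E : normedModType R[i])
    (m : nat -> R) : Prop :=
  forall (s : R) (u : formal_series E),
    qGevrey_series q s u <-> qGevrey_series q s (formal_borel m u).

Definition of_qGevrey_order (q s : R) (m : nat -> R) : Prop :=
  exists a A alpha beta : R, [/\ 0 < a, 0 < A &
    forall p : nat,
      a ^+ p * p`!%:R `^ alpha * q `^ (s * (p%:R * (p%:R - 1) / 2)) <= m p
      <= A ^+ p * p`!%:R `^ beta * q `^ (s * (p%:R * (p%:R - 1) / 2))].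

End QGevrey.

(* Main.v *)
(* Multiplying coefficients by scalars c_p <= C^p p!^gamma preserves every
   q-Gevrey class, which gives one direction with c = 1/m and c = m.
   Conversely, let e be a unit vector: the series with coefficients e and m_p e
   are, respectively, in the class s = 0 and mapped to that class by the Borel
   operator, so 1/m_p and m_p are both bounded by A B^p p!^alpha; the
   constant A is absorbed in the geometric factor because m_0 = 1. *)
Require Import Defs.
From mathcomp Require Import all_boot all_order all_algebra.
From mathcomp Require Import complex.
From mathcomp Require Import all_classical all_reals all_analysis.
From mathcomp Require Import ring.

Set Implicit Arguments.
Unset Strict Implicit.
Unset Printing Implicit Defensive.

Import Order.TTheory GRing.Theory Num.Theory.
Import numFieldNormedType.Exports.

Local Open Scope ring_scope.
Local Open Scope complex_scope.

Section QGevreyScaling.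
Context {R : realType}.

Lemma fact_powR_gt0 (p : nat) (x : R) : 0 < p`!%:R `^ x.
Proof. by rewrite powR_gt0// ltr0n fact_gt0. Qed.

Lemma normrZ_realc_le (E : normedModType R[i]) (c d x : R) (v : E) :
  0 <= c <= d -> `|v| <= x%:C -> `|c%:C *: v| <= (d * x)%:C.
Proof.
move=> /andP[c0 cd] vx; rewrite normrZ ger0_norm ?ler0c// rmorphM/=.
by apply: ler_pM => //; rewrite ?ler0c ?lecR.
Qed.

(** The factors [C ^+ p] and [gamma] merge with [B ^+ p] and [alpha]; the power of [q] is untouched,
    so the order [s] survives. *)
Lemma qGevrey_series_scale (q s C gamma : R) (E : normedModType R[i])
    (c : nat -> R) (u : formal_series E) :
  0 < C -> (forall p, 0 <= c p <= C ^+ p * p`!%:R `^ gamma) ->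
  qGevrey_series q s u -> qGevrey_series q s (fun p => (c p)%:C *: u p).
Proof.
move=> C0 cC [A [B [alpha [A0 B0 uAB]]]].
exists A, (C * B), (gamma + alpha); split=> // [|p]; first exact: mulr_gt0.
apply: le_trans (normrZ_realc_le (cC p) (uAB p)) _.
(* Exponents add only for a nonzero base when their sum may vanish; here the base is a factorial. *)
rewrite lecR powRD; last by rewrite pnatr_eq0 -lt0n fact_gt0 implybT.
by rewrite exprMn le_eqVlt; apply/orP; left; apply/eqP; ring.
Qed.

Lemma formal_borelK (m : nat -> R) (E : normedModType R[i])
    (u : formal_series E) :
  (forall p, 0 < m p) -> (fun p => (m p)%:C *: formal_borel m u p) = u.
Proof.
move=> m0; apply/funext => p.
by rewrite /formal_borel scalerA -rmorphM/= mulfV ?scale1r// gt_eqF.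
Qed.

(** As the norm takes values in the scalar field [R[i]], [x] can be scaled by the inverse of its
    norm directly. *)
Lemma exists_unit_vector (E : normedModType R[i]) :
  (exists x : E, x != 0) -> exists e : E, `|e| = 1.
Proof.
move=> [x x0]; exists (`|x|^-1 *: x).
by rewrite normrZ normfV normr_id mulVf// normr_eq0.
Qed.

Lemma qGevrey0_unit_series (q : R) (E : normedModType R[i]) (e : E) :
  `|e| = 1 -> qGevrey_series q 0 (fun=> e).
Proof.
move=> e1; exists 1, 1, 0; split=> // p.
by rewrite mul0r !powRr0 expr1n !mulr1 e1.
Qed.

Lemma qGevrey0_unit_scale_bound (q : R) (E : normedModType R[i]) (e : E)
    (c : nat -> R) :
  `|e| = 1 -> (forall p, 0 < c p) -> c 0%N = 1 ->
  qGevrey_series q 0 (fun p => (c p)%:C *: e) ->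
  exists C gamma : R, 0 < C /\ forall p, c p <= C ^+ p * p`!%:R `^ gamma.
Proof.
move=> e1 c0 c01 [A [B [g [A0 B0 cAB]]]].
have {}cAB p : c p <= A * B ^+ p * p`!%:R `^ g.
  move: (cAB p); rewrite mul0r powRr0 mulr1 normrZ e1 mulr1.
  by rewrite ger0_norm ?lecR// ltW.
(* The bound at index 0 reads [1 <= A], hence [A <= A ^+ p.+1], so [A * B] can serve as the ratio;
   index 0 itself is handled by [c 0 = 1]. *)
have A1 : 1 <= A by have := cAB 0%N; rewrite c01 expr0 powR1 !mulr1.
exists (A * B), g; split=> [|[|p]].
- exact: mulr_gt0.
- by rewrite c01 expr0 powR1 mulr1.
- apply: le_trans (cAB _) _.
  rewrite exprMn ler_pM2r ?fact_powR_gt0// ler_pM2r ?exprn_gt0//.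
  by rewrite exprS ler_peMr ?exprn_ege1// ltW.
Qed.

Lemma geometric_fact_inv (C gamma : R) (p : nat) :
  (C ^+ p * p`!%:R `^ gamma)^-1 = C^-1 ^+ p * p`!%:R `^ (- gamma).
Proof. by rewrite invfM exprVn powRN. Qed.

Lemma preserves_qGevrey_orderP (q : R) (E : normedModType R[i])
    (m : nat -> R) :
  (exists x : E, x != 0) -> (forall p, 0 < m p) -> m 0%N = 1 ->
  preserves_qGevrey_order q E m <->
  exists a A alpha beta : R, [/\ 0 < a, 0 < A &
    forall p : nat,
      a ^+ p * p`!%:R `^ alpha <= m p <= A ^+ p * p`!%:R `^ beta].
Proof.
move=> /exists_unit_vector[e e1] m_gt0 m01; split=> [pm|].
  have one_qG := qGevrey0_unit_series q e1.
  have [|||C [g [C0 invm_le]]] :=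
    qGevrey0_unit_scale_bound (q := q) (c := fun p => (m p)^-1) e1 _ _ _.
  - by move=> p; rewrite invr_gt0.
  - by rewrite m01 invr1.
  (* By definition, the Borel transform of the constant series [e] has coefficients
     [(m p)^-1 *: e]. *)
  - exact: (pm 0 _).1 one_qG.
  have [|A [b [A0 m_le]]] := qGevrey0_unit_scale_bound (q := q) e1 m_gt0 m01 _.
    (* Conversely, the Borel operator sends the series of the [m p *: e] to the constant series
       [e]. *)
    apply: (pm 0 _).2; rewrite [formal_borel _ _](_ : _ = fun=> e)//.
    apply/funext => p.
    by rewrite /formal_borel scalerA -rmorphM/= mulVf ?scale1r// gt_eqF.
  (* Inverting the upper bound on [1 / m p] gives the lower bound on [m p]. *)
  exists C^-1, A, (- g), b; split=> [||p]; rewrite ?invr_gt0//.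
  rewrite m_le andbT -geometric_fact_inv -[leRHS]invrK lef_pV2 ?invm_le//.
    by rewrite posrE mulr_gt0 ?exprn_gt0 ?fact_powR_gt0.
  by rewrite posrE invr_gt0.
move=> [a [A [al [b [a0 A0 mP]]]]] s u; split=> [uqG|].
  apply: (@qGevrey_series_scale q s a^-1 (- al)) uqG => [|p].
    by rewrite invr_gt0.
  rewrite invr_ge0 ltW//= -geometric_fact_inv lef_pV2 ?posrE//.
    by case/andP: (mP p).
  by rewrite mulr_gt0 ?exprn_gt0 ?fact_powR_gt0.
(* Scaling the Borel transform by [m] recovers [u], so the upper bound on [m] suffices. *)
move=> /(qGevrey_series_scale A0 (c := m) (gamma := b)).
rewrite formal_borelK//; apply => p.
by rewrite ltW//=; case/andP: (mP p).
Qed.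

Lemma of_qGevrey_order0P (q : R) (m : nat -> R) :
  of_qGevrey_order q 0 m <->
  exists a A alpha beta : R, [/\ 0 < a, 0 < A &
    forall p : nat,
      a ^+ p * p`!%:R `^ alpha <= m p <= A ^+ p * p`!%:R `^ beta].
Proof.
by split=> -[a [A [al [b [a0 A0 mP]]]]]; exists a, A, al, b; split=> // p;
  move: (mP p); rewrite mul0r powRr0 !mulr1.
Qed.

End QGevreyScaling.

Theorem proposition5 (R : realType) (q : R) (hq : 1 < q)
    (E : completeNormedModType R[i]) (hE : exists x : E, x != 0)
    (m : nat -> R) (hm : forall p : nat, 0 < m p) (hm0 : m 0%N = 1) :
  (preserves_qGevrey_order q E m <-> of_qGevrey_order q 0 m) /\
  (preserves_qGevrey_order q E m <->
     exists a A alpha beta : R, [/\ 0 < a, 0 < A &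
       forall p : nat,
         a ^+ p * p`!%:R `^ alpha <= m p <= A ^+ p * p`!%:R `^ beta]).
Proof.
split; last exact: preserves_qGevrey_orderP.
apply: (iff_trans (preserves_qGevrey_orderP q hE hm hm0)).
exact: iff_sym (of_qGevrey_order0P q m).
Qed.
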